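(* For every integer $\Delta \geq 3$, let $\mathcal{G}_{\Delta}$ be the family of connected signed graphs with maximum degree at most $\Delta$. Then $$2^{\Delta/2-1} \;\leq\; \chi_s(\mathcal{G}_{\Delta}) \;\leq\; (\Delta-1)^2\cdot 2^{\Delta-1}+2 .$$
   Context: Graphs are finite and simple (no loops, no multiple edges). A signed graph $(G,\Sigma)$ is a graph $G$ together with a set $\Sigma\subseteq E(G)$ of negative edges; the edges not in $\Sigma$ are positive. The maximum degree and connectedness of $(G,\Sigma)$ are those of the underlying graph $G$. To re-sign a vertex $v$ of $(G,\Sigma)$ is to switch the signs of all edges incident to $v$. Two signed graphs $(G,\Sigma)$ and $(G,\Sigma')$ are equivalent if $(G,\Sigma')$ can be obtained from $(G,\Sigma)$ by re-signing some vertices. A 2-edge-colored homomorphism of $(G,\Sigma)$ to $(H,\Lambda)$ is a map $\psi:V(G)\to V(H)$ such that for each edge $uv$ of $(G,\Sigma)$, $\psi(u)\psi(v)$ is an edge of $(H,\Lambda)$ of the same sign as $uv$. A homomorphism of $(G,\Sigma)$ to $(H,\Lambda)$ is a map $\phi:V(G)\to V(H)$ for which there exists $(G,\Sigma')$ equivalent to $(G,\Sigma)$ such that $\phi$ is a 2-edge-colored homomorphism of $(G,\Sigma')$ to $(H,\Lambda)$. The signed chromatic number $\chi_s((G,\Sigma))$ is the minimum number of vertices of a signed graph $(H,\Lambda)$ such that $(G,\Sigma)$ admits a homomorphism to $(H,\Lambda)$. For a family $\mathcal{F}$ of signed graphs, $\chi_s(\mathcal{F})=\max_{(G,\Sigma)\in\mathcal{F}}\chi_s((G,\Sigma))$.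 *)

(* Defs.v *)
From HB Require Import structures.
From mathcomp Require Import all_boot.
From mathcomp Require Import boolp.

Set Implicit Arguments.
Unset Strict Implicit.
Unset Printing Implicit Defensive.

(* A signed graph (G, Sigma) on the vertex set V: [adj] is the edge relation of
   G and [neg] that of Sigma, so that x y is a positive edge iff
   [adj x y && ~~ neg x y]. *)
Record signed_graph (V : finType) := SignedGraph {
  adj : rel V;
  neg : rel V;
  adj_sym : symmetric adj;
  adj_irr : irreflexive adj;
  neg_sym : symmetric neg;
  neg_adj : subrel neg adj }.

Section Resign.
Variables (V : finType) (G : signed_graph V) (v : V).

Definition resign_neg : rel V :=
  fun x y => adj G x y && (neg G x y (+) ((x == v) || (y == v))).

Lemma resign_neg_sym : symmetric resign_neg.
Proof.
by move=> x y; rewrite /resign_neg (adj_sym G) (neg_sym G) [(x == v) || _]orbC.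
Qed.

Lemma resign_neg_adj : subrel resign_neg (adj G).
Proof. by move=> x y /andP[]. Qed.

Definition resign : signed_graph V :=
  SignedGraph (adj_sym G) (adj_irr G) resign_neg_sym resign_neg_adj.

End Resign.

Definition equivalent (V : finType) (G G' : signed_graph V) : Prop :=
  exists s : seq V, G' = foldl (@resign V) G s.

Definition hom2ec (V W : finType) (G : signed_graph V) (H : signed_graph W)
    (psi : V -> W) : Prop :=
  forall u v, adj G u v ->
    adj H (psi u) (psi v) /\ neg H (psi u) (psi v) = neg G u v.

Definition signed_hom (V W : finType) (G : signed_graph V) (H : signed_graph W)
    (phi : V -> W) : Prop :=
  exists G' : signed_graph V, equivalent G G' /\ hom2ec G' H phi.

Definition hom_to_order (V : finType) (G : signed_graph V) (n : nat) : Prop :=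
  exists (W : finType) (H : signed_graph W) (phi : V -> W),
    #|W| = n /\ signed_hom G H phi.

Lemma ex_hom_to_order (V : finType) (G : signed_graph V) :
  exists n, `[< hom_to_order G n >].
Proof.
exists #|V|; apply/asboolP; exists V, G, id; split=> //.
by exists G; split=> //; exists [::].
Qed.

Definition chi_s (V : finType) (G : signed_graph V) : nat :=
  ex_minn (ex_hom_to_order G).

Definition max_degree (V : finType) (G : signed_graph V) : nat :=
  \max_(v : V) #|[set w | adj G v w]|.

(* The graph without vertices counts as connected; its signed chromatic number
   is 0, so it does not affect maxima over families with a nonempty graph. *)
Definition connected (V : finType) (G : signed_graph V) : Prop :=
  forall x y : V, connect (adj G) x y.

Definition signed_family := forall V : finType, signed_graph V -> Prop.

(* [m] is the maximum of chi_s over F; both that chi_s is bounded on F and that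
   the bound is attained are part of the assertion. *)
Definition is_family_chi_s (F : signed_family) (m : nat) : Prop :=
  (exists (V : finType) (G : signed_graph V), F V G /\ chi_s G = m) /\
  (forall (V : finType) (G : signed_graph V), F V G -> chi_s G <= m).

Definition bounded_degree_family (Delta : nat) : signed_family :=
  fun V G => connected G /\ max_degree G <= Delta.

(* Main.v *)
Require Import Defs.
From mathcomp Require Import all_boot all_order all_algebra.
From mathcomp Require Import reals exp.
From mathcomp Require boolp.
From mathcomp Require Import ring lra zify.
Import Order.TTheory GRing.Theory Num.Theory.

Set Implicit Arguments.
Unset Strict Implicit.
Unset Printing Implicit Defensive.

(* Upper bound. Write k = Delta - 1.  A random complete signed graph on
   t = k^2 2^k vertices has, with positive probability, the property that for
   every k-set J and every sign pattern a on J at least k vertices outside J are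
   joined to J with signs a or -a; adding vertices to J one at a time, which
   doubles the number of patterns, smaller sets of size j then have more than
   (k + 1 - j)(k - 1) such vertices.  Given an edge xy of a connected graph, the
   vertices other than x, y can be ordered so that each has a later neighbour.
   Mapping them greedily in this order, a vertex with j mapped neighbours must
   avoid at most (k + 1 - j)(k - 1) images to keep the images of the neighbours of
   every later vertex distinct.  Finally x and y go to two additional vertices,
   whose signs can be chosen freely since their neighbours have distinct images.

   Lower bound. If every signature of a Delta-regular bipartite graph on 2n
   vertices maps to at most m vertices, the signature is determined by the signs
   on m vertices, the map and the re-signed set, so
   2^(n Delta) <= 2^(m^2) (2m)^(2n); as n grows, 2^Delta <= (2m)^2. *)

(** * Numerical estimates for the union bound *)

Lemma leq_exp2_fact k : (4 <= k)%N -> (2 ^ k <= k`!)%N.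
Proof.
elim: k => // k IHk; rewrite leq_eqVlt => /predU1P[<- // | k_ge4].
by rewrite factS expnS leq_mul ?IHk // (leq_trans _ k_ge4).
Qed.

Lemma leq_ffact_exp n k : (n ^_ k <= n ^ k)%N.
Proof.
elim: k => // k IHk.
by rewrite ffactnSr expnSr leq_mul ?leq_subr.
Qed.

Section RealEstimates.
Local Open Scope ring_scope.
Variable R : realFieldType.

Lemma cube_le_exp k : (6 <= k)%N -> 4 * k%:R ^+ 3 <= (16 / 5) ^+ k :> R.
Proof.
elim: k => // k IHk; rewrite leq_eqVlt => /predU1P[<- | k_ge6]; first by lra.
have k6 : 6 <= k%:R :> R by rewrite (ler_nat R 6).
have {}IHk := IHk k_ge6.
rewrite [leRHS]exprS -natr1; apply: le_trans (_ : 16 / 5 * (4 * k%:R ^+ 3) <= _).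
  by nra.
by rewrite ler_wpM2l ?divr_ge0.
Qed.

Lemma bernoulli (x : R) n : 0 <= x -> 1 + x *+ n <= (1 + x) ^+ n.
Proof.
move=> x_ge0; elim: n => [|n IHn]; first by rewrite mulr0n addr0 expr0.
rewrite exprS; apply: le_trans (ler_wpM2l _ IHn); last by rewrite addr_ge0.
rewrite mulrS; have := mulrn_wge0 n x_ge0; set y := x *+ n => y_ge0; nra.
Qed.

Lemma bernoulliB (x : R) n : 0 <= x <= 1 -> 1 - x *+ n <= (1 - x) ^+ n.
Proof.
move=> /andP[x_ge0 x_le1]; elim: n => [|n IHn].
  by rewrite mulr0n subr0 expr0.
rewrite exprS; apply: le_trans (ler_wpM2l _ IHn); last by rewrite subr_ge0.
rewrite mulrS; have := mulrn_wge0 n x_ge0; set y := x *+ n => y_ge0; nra.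
Qed.

Lemma union_bound_cast (t M q f k n : nat) :
  t%:R ^+ k * M%:R * (M.-1%:R * q%:R + 1) ^+ n * q%:R ^+ k.-1
    < f%:R * (M%:R * q%:R) ^+ n :> R ->
  (t ^ k * M * (M.-1 * q + 1) ^ n * q ^ k.-1 < f * (M * q) ^ n)%N.
Proof. by rewrite -(ltr_nat R) !natrM !natrX natrD !natrM. Qed.

(* 1/q is the Chernoff parameter; q = 4k is close enough to optimal for the
   bound to hold already at k = 2 and k = 3, where there is little room. *)
Lemma union_bound_small k (t := (k ^ 2 * 2 ^ k)%N) (M := (2 ^ k.-1)%N)
    (q := (4 * k)%N) :
  (1 < k < 6)%N ->
  t%:R ^+ k * M%:R * (M.-1%:R * q%:R + 1) ^+ (t - k) * q%:R ^+ k.-1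
    < k`!%:R * (M%:R * q%:R) ^+ (t - k) :> R.
Proof.
case/andP; case: k @t @M @q => [|[|k]] t M q // _.
do 4?case: k @t @M @q => [|k] t M q; last by rewrite !ltnS ltn0.
- have -> : t = 16%N by []. have -> : M = 2%N by []. have -> : q = 8%N by [].
  move=> _; rewrite -[2`!]/2%N -[2.-1]/1%N -[(16 - 2)%N]/14%N; lra.
- have -> : t = 72%N by []. have -> : M = 4%N by []. have -> : q = 12%N by [].
  move=> _; rewrite -[3`!]/6%N -[4.-1]/3%N -[3.-1]/2%N -[(72 - 3)%N]/69%N; lra.
- have -> : t = 256%N by []. have -> : M = 8%N by []. have -> : q = 16%N by [].
  move=> _; rewrite -[4`!]/24%N -[8.-1]/7%N -[4.-1]/3%N -[(256 - 4)%N]/252%N; lra.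
- have -> : t = 800%N by []. have -> : M = 16%N by []. have -> : q = 20%N by [].
  move=> _; rewrite -[5`!]/120%N -[16.-1]/15%N -[5.-1]/4%N -[(800 - 5)%N]/795%N; lra.
Qed.

(* Here 16 m = 2^(k-1), so that m (32 k^2) = k^2 2^k, and y = 1 - 1/(4k). *)
Lemma ratio_pow_le (k m : nat) (x y : R) :
  (0 < k)%N -> (0 < m)%N -> (k <= 8 * m)%N -> 23 / 24 <= y <= 1 ->
  x * (16 * m%:R) = y ->
  (1 - x) ^+ (m * (32 * k ^ 2) - k) <= 2 * (5 / 32) ^+ k ^+ k.
Proof.
move=> k_gt0 m_gt0 k_le y_bnd xm_eq.
have mR : 1 <= m%:R :> R by rewrite ler1n.
have x_ge0 : 0 <= x by nra.
have x_le1 : x <= 1 by nra.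
have mx_eq : x *+ m = y / 16 by rewrite -mulr_natr; lra.
have p_ge0 n : 0 <= (1 - x) ^+ n by rewrite exprn_ge0; lra.
(* 5299/5000 lies just below 1 + 23/384, a lower bound for 1 + y/16, and its 32nd power exceeds
   32/5; this is where 5/32 comes from. *)
have pow_m : (1 - x) ^+ m <= 5000 / 5299.
  have lb : 5299 / 5000 <= (1 + x) ^+ m.
    by apply: le_trans (bernoulli m x_ge0); rewrite mx_eq; move: y_bnd; clear; lra.
  (* (1 - x)^m is bounded through (1 - x)(1 + x) <= 1 and Bernoulli. *)
  have ub : (1 - x) ^+ m * (1 + x) ^+ m <= 1.
    rewrite -exprMn -subr_sqr expr1n exprn_ile1 ?subr_ge0 ?exprn_ile1 //.
    by rewrite gerBl sqr_ge0.
  by move: lb ub (p_ge0 m); clear; nra.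
have pow_t : (1 - x) ^+ (m * (32 * k ^ 2)) <= (5 / 32) ^+ k ^+ k.
  rewrite -[leRHS]exprM mulnn exprM exprM.
  rewrite lerXn2r ?nnegrE ?exprn_ge0 ?divr_ge0 ?subr_ge0 //.
  apply: le_trans (_ : (5000 / 5299) ^+ 32 <= _); last by lra.
  by rewrite lerXn2r ?nnegrE ?divr_ge0.
(* The factor 2 in the conclusion pays for the k missing factors: (1 - x)^k >= 1 - 8mx = 1 - y/2 >=
   1/2. *)
have pow_k : 2^-1 <= (1 - x) ^+ k.
  apply: le_trans (bernoulliB k _); last by rewrite x_ge0.
  have : x *+ k <= x *+ (8 * m) by rewrite ler_wpMn2l.
  by rewrite mulnC mulrnA mx_eq -mulr_natr; move: y_bnd; clear; lra.
have k_le_t : (k <= m * (32 * k ^ 2))%N.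
  by rewrite -mulnn !mulnA leq_pmull ?muln_gt0 ?m_gt0.
rewrite -(subnK k_le_t) exprD in pow_t.
by move: pow_t pow_k (p_ge0 (m * (32 * k ^ 2) - k)%N); clear; nra.
Qed.

Lemma miss_weight_eq (m q : R) : m != 0 -> q != 0 ->
  (16 * m - 1) * q + 1 = (1 - (1 - 1 / q) / (16 * m)) * (16 * m * q).
Proof. by move=> m0 q0; field; rewrite m0. Qed.

(** After division by (Mq)^(t-k), [ratio_pow_le] bounds the remaining power by 2 (5/32)^(k^2). Since
    2M = 2^k, q times the left side is then at most twice the k-th power of 2tq(5/32)^k = 8k^3
    (5/16)^k <= 2, the extra 2 being already part of the bound on the power; finally 2^k <= k!, and
    q >= 2 makes the inequality strict. *)
Lemma union_bound_large k (t := (k ^ 2 * 2 ^ k)%N) (M := (2 ^ k.-1)%N)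
    (q := (4 * k)%N) :
  (5 < k)%N ->
  t%:R ^+ k * M%:R * (M.-1%:R * q%:R + 1) ^+ (t - k) * q%:R ^+ k.-1
    < k`!%:R * (M%:R * q%:R) ^+ (t - k) :> R.
Proof.
move=> k_ge6; have k_gt0 : (0 < k)%N by apply: leq_trans k_ge6.
pose m := (2 ^ (k - 5))%N.
have M_eq : M = (16 * m)%N by rewrite /m -(expnD 2 4) /M; congr expn; lia.
have m_gt0 : (0 < m)%N by rewrite expn_gt0.
have k_le : (k <= 8 * m)%N.
  by have := ltn_expl (k - 5) (isT : 1 < 2)%N; rewrite -/m; lia.
have t_eq : t = (m * (32 * k ^ 2))%N.
  have -> : t = (k ^ 2 * (2 * M))%N by rewrite /M -expnS prednK.
  by rewrite M_eq; ring.
have kR : 6 <= k%:R :> R by rewrite (ler_nat R 6).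
have m0 : m%:R != 0 :> R by rewrite pnatr_eq0 -lt0n.
have k0 : 4 * k%:R != 0 :> R by apply/lt0r_neq0; clear -kR; lra.
pose z : R := 1 / (4 * k%:R).
have y_bnd : 23 / 24 <= 1 - z <= 1.
  have z_ge0 : 0 <= z by apply: divr_ge0; clear -kR; lra.
  have z_le : z <= 1 / 24 by rewrite ler_pdivrMr; clear -kR; lra.
  by clear -z_ge0 z_le; lra.
have M1_eq : M.-1%:R = 16 * m%:R - 1 :> R.
  by rewrite M_eq -subn1 natrB ?natrM // muln_gt0.
have tR : t%:R = k%:R ^+ 2 * 2 ^+ k :> R by rewrite /t natrM !natrX.
have MR : M%:R = 16 * m%:R :> R by rewrite M_eq natrM.
have M2R : 2 * M%:R = 2 ^+ k :> R.
  by rewrite /M -(natrM R 2) -expnS prednK // natrX.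
have qR : q%:R = 4 * k%:R :> R by rewrite natrM.
clearbody t M q m.
have m16_0 : 16 * m%:R != 0 :> R by rewrite mulf_neq0 // pnatr_eq0.
have r_le := ratio_pow_le k_gt0 m_gt0 k_le y_bnd (divfK m16_0 _).
rewrite M1_eq MR qR miss_weight_eq // -/z exprMn.
rewrite -t_eq in r_le; set r := (1 - _) ^+ _ in r_le *.
set P := (_ * (4 * _)) ^+ _.
have P_gt0 : 0 < P by rewrite exprn_gt0 ?mulr_gt0 ?ltr0n.
rewrite [ltLHS]mulrAC [ltLHS]mulrA ltr_pM2r // -MR -qR.
have T_ge0 : 0 <= t%:R ^+ k * M%:R * q%:R ^+ k.-1 :> R.
  by rewrite !mulr_ge0 ?exprn_ge0.
have fact_ge : t%:R ^+ k * M%:R * q%:R ^+ k.-1 * (2 * (5 / 32) ^+ k ^+ k) * q%:R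
    <= k`!%:R :> R.
  have -> : t%:R ^+ k * M%:R * q%:R ^+ k.-1 * (2 * (5 / 32) ^+ k ^+ k) * q%:R =
      (t%:R * 2 * q%:R * (5 / 32) ^+ k) ^+ k :> R.
    rewrite !exprMn -M2R -[in q%:R ^+ k](prednK k_gt0) exprSr; ring.
  apply: le_trans (_ : 2 ^+ k <= _); last first.
    by rewrite -natrX ler_nat leq_exp2_fact // ltnW // ltnW.
  rewrite lerXn2r ?nnegrE ?mulr_ge0 ?exprn_ge0 ?divr_ge0 //.
  rewrite tR qR.
  have -> : k%:R ^+ 2 * 2 ^+ k * 2 * (4 * k%:R) * (5 / 32) ^+ k =
    2 * (4 * k%:R ^+ 3 * (5 / 16) ^+ k) :> R.
    have -> : 5 / 16 = 2 * (5 / 32) :> R by field.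
    rewrite [(_ * (_ / _)) ^+ _]exprMn; ring.
  have c_eq : (16 / 5) ^+ k * (5 / 16) ^+ k = 1 :> R.
    by rewrite -exprMn (_ : _ * _ = 1) ?expr1n //; field.
  have c_ge0 : 0 <= (5 / 16) ^+ k :> R by rewrite exprn_ge0 ?divr_ge0.
  by have := ler_wpM2r c_ge0 (cube_le_exp k_ge6); rewrite c_eq; clear; lra.
have f_gt0 : 0 < k`!%:R :> R by rewrite ltr0n fact_gt0.
have q_gt1 : 2 <= q%:R :> R by rewrite qR; clear -kR; lra.
apply: le_lt_trans (ler_wpM2l T_ge0 r_le) _.
by move: fact_ge f_gt0 q_gt1; clear; set A := _ * (2 * _); nra.
Qed.

End RealEstimates.

(** With denominators cleared, this says that the expected number of failures is below 1: there are
    C(t, k) sets and M patterns up to negation, and each pair fails with probability at most ((M-1)q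
    + 1)^(t-k) q^(k-1) / (Mq)^(t-k). *)
Lemma union_bound_numeric k (t := k ^ 2 * 2 ^ k) (M := 2 ^ k.-1) (q := 4 * k) :
  1 < k ->
  'C(t, k) * M * (M.-1 * q + 1) ^ (t - k) * q ^ k.-1 < (M * q) ^ (t - k).
Proof.
move=> k_gt1.
have C_le : 'C(t, k) * k`! <= t ^ k.
  by rewrite bin_ffact leq_ffact_exp.
rewrite -(ltn_pmul2l (fact_gt0 k)).
apply: leq_ltn_trans (_ : t ^ k * M * (M.-1 * q + 1) ^ (t - k) * q ^ k.-1 < _).
  by rewrite -!mulnA mulnA leq_mul // mulnC.
apply: (@union_bound_cast rat).
have [k_lt6 | k_ge6] := ltnP k 6.
  by apply: union_bound_small; rewrite k_gt1.
exact: union_bound_large.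
Qed.

(** * Random signatures and the probability of few extensions *)

(* Markov's inequality for q to the number of misses. *)
Lemma card_few_hits (L P : finType) (G : L -> {set P}) (g q n : nat) :
  0 < q -> (forall h, #|G h| = g) ->
  #|[set f : {ffun L -> P} | #|[set h | f h \in G h]| <= n]| * q ^ #|L|
    <= ((#|P| - g) * q + g) ^ #|L| * q ^ n.
Proof.
move=> q_gt0 cardG; set B := [set f | _].
pose w h p := if p \in G h then 1 else q.
have w_sum h : \sum_p w h p = (#|P| - g) * q + g.
  rewrite (bigID (mem (G h))) /= addnC; congr (_ + _).
    rewrite (eq_bigr (fun=> q)) => [|p]; last by rewrite /w => /negbTE ->.
    rewrite sum_nat_const -(cardG h) -(cardsC (G h)) addKn.
    by congr (_ * _); apply: eq_card => p; rewrite !inE.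
  rewrite (eq_bigr (fun=> 1)) => [|p]; last by rewrite /w => ->.
  by rewrite sum_nat_const muln1 cardG.
have -> : ((#|P| - g) * q + g) ^ #|L| =
    \sum_(f : {ffun L -> P}) \prod_h w h (f h).
  rewrite -(bigA_distr_bigA w) (eq_bigr _ (fun h _ => w_sum h)).
  by rewrite prod_nat_const.
rewrite -sum1_card big_distrl [X in _ <= X]big_distrl /=.
rewrite [X in _ <= X](bigID (mem B)) /=; apply: leq_trans (leq_addr _ _).
apply: leq_sum => f; rewrite inE mul1n => few.
have -> : \prod_h w h (f h) = q ^ #|[set h | f h \notin G h]|.
  rewrite (bigID [pred h | f h \in G h]) /= big1 ?mul1n => [|h]; last first.
    by rewrite /w => ->.
  rewrite (eq_bigr (fun=> q)) => [|h]; last by rewrite /w => /negbTE ->.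
  by rewrite prod_nat_const; congr (q ^ _); apply: eq_card => h; rewrite !inE.
rewrite -expnD leq_pexp2l //.
rewrite -(cardsC [set h | f h \in G h]) addnC leq_add // subset_leq_card //.
by apply/subsetP => h; rewrite !inE.
Qed.

(* [c] accounts for a possible re-signing of the new vertex. *)
Definition extensions (T : finType) (s : rel T) (J : {set T}) (a : T -> bool) :=
  [set h | (h \notin J) && [exists c, forall x in J, s h x == a x (+) c]].

Section RandomSignature.
Variable T : finType.
Implicit Types (w : {ffun T * T -> bool}) (J : {set T}) (a : T -> bool).

(** Summing the two entries of a pair gives a symmetric signature without any constraint on [w], so
    the sample space is a full function space. *)
Definition symmetrize w : rel T := fun x y => w (x, y) (+) w (y, x).

Lemma symmetrize_sym w : symmetric (symmetrize w).
Proof. by move=> x y; rewrite /symmetrize addbC. Qed.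

Section Shift.
Variable J : {set T}.
Local Notation In := {x | x \in J}.
Local Notation Out := {x | x \notin J}.

(* The signs between J and its complement are randomized by adding tau: for a
   fixed w, the rows of signs from J to the vertices outside J are independent. *)
Definition shift (tau : {ffun Out -> {ffun In -> bool}}) w :
    {ffun T * T -> bool} :=
  [ffun p => w p (+)
     oapp (fun h => oapp (tau h) false (insub p.2)) false (insub p.1)].

Lemma shiftK tau : involutive (shift tau).
Proof. by move=> w; apply/ffunP => p; rewrite !ffunE addbK. Qed.

Lemma symmetrize_shift tau w (h : Out) (x : In) :
  symmetrize (shift tau w) (val h) (val x) =
    symmetrize w (val h) (val x) (+) tau h x.
Proof.
rewrite /symmetrize !ffunE /= !valK /= [insub (val x)]insubF /=; last first.
  by rewrite (valP x).
by rewrite addbF addbAC.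
Qed.

(** Each [shift tau] permutes the sample space, so the bad [w] can be counted by averaging over
    [tau] with [w] fixed. Then [card_few_hits] applies: an outer vertex is an extension iff its row
    is one of two rows, one for each [c], which differ because [J] is nonempty. *)
Lemma card_few_extensions a q n : 0 < q -> 0 < #|J| ->
  #|[set w | #|extensions (symmetrize w) J a| <= n]| *
      (2 ^ #|J|.-1 * q) ^ (#|T| - #|J|) <=
  #|{ffun T * T -> bool}| *
      (((2 ^ #|J|.-1).-1 * q + 1) ^ (#|T| - #|J|) * q ^ n).
Proof.
move=> q_gt0 J_gt0; set B := [set w | _].
have cardIn : #|{: In}| = #|J| by rewrite card_sig.
have cardOut : #|{: Out}| = #|T| - #|J|.
  rewrite card_sig -(cardsC J) addKn.
  by apply: eq_card => x; rewrite !inE.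
pose G w (h : Out) : {set {ffun In -> bool}} :=
  [set [ffun x => symmetrize w (val h) (val x) (+) a (val x) (+) c] | c : bool].
have cardG w h : #|G w h| = 2.
  rewrite card_imset ?card_bool // => c d /ffunP.
  have [x xJ] := card_gt0P J_gt0.
  by move=> /(_ (Sub x xJ)); rewrite !ffunE => /addbI.
have shiftB tau w :
    (shift tau w \in B) = (#|[set h | tau h \in G w h]| <= n).
  rewrite inE; congr (_ <= n).
  rewrite -(card_imset _ val_inj); apply: eq_card => h.
  rewrite inE; apply/andP/imsetP => [[hJ /existsP[c /forall_inP ext_h]]|].
    exists (Sub h hJ) => //; rewrite inE; apply/imsetP; exists c => //.
    apply/ffunP => x; rewrite ffunE /= -addbA -(eqP (ext_h _ (valP x))).
    by rewrite -[h]/(val (Sub h hJ : Out)) symmetrize_shift addKb.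
  case=> u; rewrite inE => /imsetP[c _ tau_u] ->; split; first exact: (valP u).
  apply/existsP; exists c; apply/forall_inP => x xJ.
  rewrite -[x]/(val (Sub x xJ : In)) symmetrize_shift tau_u ffunE.
  by rewrite -addbA addKb.
have double : #|B| * #|{ffun Out -> {ffun In -> bool}}| =
    \sum_w #|[set tau : {ffun Out -> {ffun In -> bool}} |
               #|[set h | tau h \in G w h]| <= n]|.
  under eq_bigr do rewrite -sum1dep_card big_mkcond /=.
  rewrite exchange_big /= mulnC -sum_nat_const.
  apply: eq_bigr => tau _; rewrite -big_mkcond sum1dep_card.
  rewrite -(card_imset _ (inv_inj (shiftK tau))).
  apply: eq_card => w; rewrite -{2}[w](shiftK tau) mem_imset.
    by rewrite [RHS]inE -shiftB shiftK.
  exact: inv_inj (shiftK tau).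
have cardP : #|{ffun In -> bool}| = 2 * 2 ^ #|J|.-1.
  by rewrite card_ffun card_bool cardIn -expnS prednK.
have M_gt0 : 0 < 2 ^ #|J|.-1 by rewrite expn_gt0.
(* Two good rows out of 2^#|J| amount to one out of 2^(#|J|-1); the common factor 2 appears once per
   outer vertex. *)
rewrite -(leq_pmul2r (_ : 0 < 2 ^ (#|T| - #|J|))) ?expn_gt0 //.
have -> : #|B| * (2 ^ #|J|.-1 * q) ^ (#|T| - #|J|) * 2 ^ (#|T| - #|J|) =
  #|B| * #|{ffun Out -> {ffun In -> bool}}| * q ^ #|{: Out}|.
  by rewrite card_ffun cardP cardOut !expnMn; ring.
rewrite double big_distrl /=.
pose X := ((#|{ffun In -> bool}| - 2) * q + 2) ^ #|{: Out}| * q ^ n.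
apply: leq_trans (_ : \sum_(w : {ffun T * T -> bool}) X <= _).
  by apply: leq_sum => w _; apply: card_few_hits.
rewrite sum_nat_const /X cardP cardOut.
have -> : (2 * 2 ^ #|J|.-1 - 2) * q + 2 = 2 * ((2 ^ #|J|.-1).-1 * q + 1).
  by rewrite -[(2 ^ _).-1]subn1 mulnDr mulnA mulnBr muln1.
by rewrite expnMn leq_eqVlt; apply/orP; left; apply/eqP; ring.
Qed.

End Shift.

End RandomSignature.

(** * A signature with many extensions of every small pattern *)

Lemma eq_extensions (T : finType) (s : rel T) (J : {set T}) (a b : T -> bool) d :
  (forall x, x \in J -> b x = a x (+) d) ->
  extensions s J b = extensions s J a.
Proof.
move=> ab; apply/setP => h; rewrite !inE; congr (_ && _).
apply/existsP/existsP => -[c /forall_inP ext_h]; exists (c (+) d);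
  apply/forall_inP => x xJ; rewrite (eqP (ext_h x xJ)) ab //;
  by move: (a x) => y; clear; case: y c d => [] [] [].
Qed.

(** The two ways of continuing [a] to [y] have disjoint sets of extensions: a vertex of the nonempty
    [J] determines [c], and [c] then determines the sign at [y]. *)
Lemma extensions_double (T : finType) (s : rel T) (J : {set T}) (a : T -> bool) y m :
  0 < #|J| -> y \notin J ->
  (forall b, m <= #|extensions s (y |: J) b|) ->
  m.*2 <= #|extensions s J a|.
Proof.
move=> J_gt0 yJ ext_y.
pose b v x := if x == y then v else a x.
pose E v := extensions s (y |: J) (b v).
have E_sign v h : h \in E v -> exists2 c, s h y = v (+) c &
    forall x, x \in J -> s h x = a x (+) c.
  rewrite inE => /andP[_ /existsP[c /forall_inP ext_h]]; exists c.
    by rewrite (eqP (ext_h y (setU11 y J))) /b eqxx.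
  move=> x xJ; rewrite (eqP (ext_h x (setU1r y xJ))) /b.
  by case: eqP xJ => // ->; rewrite (negbTE yJ).
have E_sub v : E v \subset extensions s J a.
  apply/subsetP => h hE; have [c _ hc] := E_sign v h hE.
  move: hE; rewrite !inE negb_or => /andP[/andP[_ ->] _] /=.
  by apply/existsP; exists c; apply/forall_inP => x xJ; rewrite hc.
have disj : [disjoint E true & E false].
  apply/pred0P => h /=; apply/andP => -[/E_sign[c yc hc] /E_sign[d yd hd]].
  have [x xJ] := card_gt0P J_gt0.
  by move: yd; rewrite yc (addbI (etrans (esym (hc x xJ)) (hd x xJ))); case: d {hd}.
rewrite -addnn; apply: leq_trans (leq_add (ext_y (b true)) (ext_y (b false))) _.
have := leq_card_setU (E true) (E false); case=> _; rewrite disj => /eqP <-.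
by rewrite subset_leq_card // subUset !E_sub.
Qed.

Lemma extensions_lower (T : finType) (s : rel T) k (J : {set T}) (a : T -> bool) :
  (forall (K : {set T}) b, #|K| = k -> k <= #|extensions s K b|) ->
  0 < #|J| <= k -> k <= #|T| ->
  2 ^ (k - #|J|) * k <= #|extensions s J a|.
Proof.
move=> ext_k /andP[J_gt0 J_le] k_le; move Ed: (k - #|J|) => d.
elim: d J a J_gt0 J_le Ed => [|d IHd] J a J_gt0 J_le Ed.
  by rewrite mul1n ext_k //; lia.
have [y yJ] : exists y, y \in ~: J by apply/card_gt0P; have := cardsC J; lia.
rewrite inE in yJ.
rewrite expnS -mulnA mul2n; apply: (@extensions_double _ s J a y) => // b.
by apply: IHd; rewrite cardsU1 yJ; lia.
Qed.

Lemma exists_extension_property (T : finType) k : 1 < k -> #|T| = k ^ 2 * 2 ^ k ->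
  exists2 s : rel T, symmetric s & forall (J : {set T}) (a : T -> bool),
    #|J| <= k -> (k.+1 - #|J|) * k.-1 < #|extensions s J a|.
Proof.
move=> k_gt1 cardT.
have k_le_T : k <= #|T| by rewrite cardT; nia.
suff [s s_sym ext_k] : exists2 s : rel T, symmetric s &
    forall (J : {set T}) a, #|J| = k -> k <= #|extensions s J a|.
  (* Doubling cannot start from the empty set, but there every vertex is an extension and t > (k +
     1)(k - 1). *)
  exists s => // J a J_le; have [J0 | J_gt0] := posnP #|J|.
    have -> : extensions s J a = setT.
      move/eqP: J0; rewrite cards_eq0 => /eqP->; apply/setP => h; rewrite !inE.
      by apply/existsP; exists true; apply/forall_inP => x; rewrite inE.
    rewrite cardsT cardT J0 subn0.
    have : 0 < 2 ^ k by rewrite expn_gt0.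
    rewrite -mulnn; nia.
  apply: leq_trans (extensions_lower a ext_k _ k_le_T); last by rewrite J_gt0.
  (* With d = k - #|J|, the bound 2^d >= d + 1 gives 2^d k > (d + 1)(k - 1). *)
  have := ltn_expl (k - #|J|) (isT : 1 < 2); move: (2 ^ _) => e; nia.
have x0 : T by apply: enum_val; apply: Ordinal (_ : 0 < #|T|); lia.
(* A pattern and its negation have the same extensions, so it suffices to treat
   the patterns that are positive at one chosen vertex of J. *)
pose J0 (J : {set T}) := J :\ odflt x0 [pick x in J].
pose B (J A : {set T}) : {set {ffun T * T -> bool}} :=
  [set w | #|extensions (symmetrize w) J (mem A)| <= k.-1].
have cardJ0 (J : {set T}) : #|J| = k -> #|powerset (J0 J)| = 2 ^ k.-1.
  move=> cardJ; rewrite card_powerset; congr (2 ^ _).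
  rewrite /J0; case: pickP => [x xJ | J_empty] /=.
    by move: (cardsD1 x J); rewrite xJ cardJ => ->.
  by have := eq_card0 J_empty; rewrite cardJ => k0; rewrite k0 in k_gt1.
have /existsP[w w_good] : [exists w, [forall J : {set T}, (#|J| == k) ==>
    [forall A in powerset (J0 J), w \notin B J A]]].
  apply: contraT; rewrite negb_exists => /forallP all_bad; exfalso.
  (* [S] counts all failures over triples of [w], [J], [A]. If every [w] failed somewhere, [S] would
     be at least the number of all [w], against the union bound. *)
  pose S := \sum_(J : {set T} | #|J| == k) \sum_(A in powerset (J0 J)) #|B J A|.
  have card_le : #|{ffun T * T -> bool}| <= S.
    have -> : S = \sum_w \sum_(J : {set T} | #|J| == k)
        \sum_(A in powerset (J0 J)) (w \in B J A).
      rewrite exchange_big; apply: eq_bigr => J _.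
      rewrite exchange_big; apply: eq_bigr => A _.
      by rewrite -sum1_card big_mkcond; apply: eq_bigr => w _; case: (w \in _).
    rewrite -sum1_card; apply: leq_sum => w _.
    have := all_bad w; rewrite negb_forall => /existsP[J].
    rewrite negb_imply => /andP[cardJ]; rewrite negb_forall => /existsP[A].
    rewrite negb_imply negbK => /andP[AJ wB].
    by rewrite (bigD1 J) //= (bigD1 A) //= wB.
  pose N := #|T| - k; pose M := 2 ^ k.-1; pose q := 4 * k.
  have M_gt0 : 0 < M by rewrite expn_gt0.
  have S_le : S * (M * q) ^ N <= #|{ffun T * T -> bool}| *
      ('C(#|T|, k) * M * (M.-1 * q + 1) ^ N * q ^ k.-1).
    rewrite /S big_distrl /=.
    pose X := #|{ffun T * T -> bool}| * ((M.-1 * q + 1) ^ N * q ^ k.-1).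
    apply: leq_trans (_ : \sum_(J : {set T} | #|J| == k) M * X <= _).
      apply: leq_sum => J /eqP cardJ; rewrite big_distrl /=.
      rewrite -[M in leqRHS](cardJ0 J cardJ) -[leqRHS]sum_nat_const.
      apply: leq_sum => A _.
      have q_gt0 : 0 < q by rewrite muln_gt0 (ltnW k_gt1).
      have J_gt0 : 0 < #|J| by rewrite cardJ (ltnW k_gt1).
      have := card_few_extensions (mem A) k.-1 q_gt0 J_gt0.
      by rewrite cardJ.
    rewrite sum_nat_const -[X in X * (M * _)]cardsE card_draws /X.
    by rewrite leq_eqVlt; apply/orP; left; apply/eqP; ring.
  have Omega_gt0 : 0 < #|{ffun T * T -> bool}|.
    by apply/card_gt0P; exists [ffun=> true].
  have := union_bound_numeric k_gt1; rewrite -cardT -/M -/q -/N.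
  rewrite ltnNge -(leq_pmul2l Omega_gt0) => /negP; apply.
  apply: leq_trans S_le; exact: leq_mul.
exists (symmetrize w); first exact: symmetrize_sym.
move=> J a cardJ.
pose j0 := odflt x0 [pick x in J].
pose A := [set x in J | a x != a j0].
have -> : extensions (symmetrize w) J a = extensions (symmetrize w) J (mem A).
  apply: (eq_extensions _ (d := a j0)) => x xJ.
  by rewrite /= inE xJ; case: (a x) (a j0) => [] [].
move/forallP/(_ J): w_good; rewrite cardJ eqxx => /forall_inP/(_ A).
rewrite !inE -ltnNge prednK ?(ltnW k_gt1) //; apply.
apply/subsetP => x; rewrite !inE => /andP[-> ax].
by rewrite andbT; apply: contraNneq ax => ->.
Qed.

(** * Homomorphisms in terms of switching functions *)

Definition neighbours (V : finType) (G : signed_graph V) (v : V) : {set V} :=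
  [set w | adj G v w].

Lemma adj_foldl_resign (V : finType) (G : signed_graph V) (vs : seq V) :
  adj (foldl (@resign V) G vs) = adj G.
Proof. by elim: vs G => //= v vs IHvs G; rewrite IHvs. Qed.

Lemma neg_foldl_resign (V : finType) (G : signed_graph V) (vs : seq V) u w :
  adj G u w ->
  neg (foldl (@resign V) G vs) u w =
    neg G u w (+) odd (count_mem u vs) (+) odd (count_mem w vs).
Proof.
elim: vs G => [|v vs IHvs] G uw /=; first by rewrite !addbF.
rewrite IHvs //= /resign_neg uw /= !oddD !oddb ![v == _]eq_sym.
have: ~~ ((u == v) && (w == v)).
  by apply: contraTN uw => /andP[/eqP-> /eqP->]; rewrite (adj_irr G).
by case: eqP; case: eqP; case: (odd _) (odd _) (neg G u w) => [] [] [].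
Qed.

(** Only the parity of the number of re-signings of each vertex matters, so a sequence of
    re-signings amounts to a Boolean function on the vertices. *)
Lemma signed_homP (V W : finType) (G : signed_graph V) (H : signed_graph W)
    (phi : V -> W) :
  signed_hom G H phi <->
  exists sg : V -> bool, forall u w, adj G u w ->
    adj H (phi u) (phi w) /\
    neg H (phi u) (phi w) = neg G u w (+) sg u (+) sg w.
Proof.
split=> [[_ [[vs ->] homG]] | [sg homG]].
  exists (fun u => odd (count_mem u vs)) => u w uw; have := homG u w.
  by rewrite adj_foldl_resign neg_foldl_resign //; apply.
exists (foldl (@resign V) G (enum sg)); split; first by exists (enum sg).
have count_sg u : odd (count_mem u (enum sg)) = sg u.
  by rewrite count_uniq_mem ?enum_uniq // mem_enum oddb.
move=> u w; rewrite adj_foldl_resign => uw; rewrite neg_foldl_resign //.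
by rewrite !count_sg; apply: homG.
Qed.

Lemma chi_s_le (V : finType) (G : signed_graph V) n :
  hom_to_order G n -> chi_s G <= n.
Proof.
move=> Gn; rewrite /chi_s; case: ex_minnP => m _; apply; exact/boolp.asboolP.
Qed.

Lemma chi_s_hom (V : finType) (G : signed_graph V) : hom_to_order G (chi_s G).
Proof. by rewrite /chi_s; case: ex_minnP => m /boolp.asboolP. Qed.

(** * Greedy colouring of all but two adjacent vertices *)

Section Greedy.
Variables (V T : finType) (G : signed_graph V) (s : rel T) (k : nat).
Hypotheses (deg_le : forall v, #|neighbours G v| <= k.+1) (s_sym : symmetric s).
Hypothesis ext_lb : forall (J : {set T}) (a : T -> bool), #|J| <= k ->
  (k.+1 - #|J|) * k.-1 < #|extensions s J a|.
Hypothesis conG : Defs.connected G.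

(* The second condition keeps the neighbours of each uncoloured vertex at distinct
   colours, so that any signs towards them can be prescribed. *)
Definition coloring_off (S : {set V}) (col : V -> T) (sg : V -> bool) :=
  (forall u w, u \notin S -> w \notin S -> adj G u w ->
    col u != col w /\ s (col u) (col w) = neg G u w (+) sg u (+) sg w) /\
  (forall w, w \in S -> {in neighbours G w :\: S &, injective col}).

Lemma boundary_edge (S : {set V}) x : x \in S -> S != setT ->
  exists2 z, z \in S & exists2 v, v \notin S & adj G z v.
Proof.
move=> xS S_proper.
have [v0 v0S] : exists v, v \notin S.
  apply/existsP; apply: contraNT S_proper; rewrite negb_exists => /forallP all_S.
  by apply/eqP/setP => v; rewrite inE; apply/negPn/all_S.
case: (pickP [pred p | [&& p.1 \in S, p.2 \notin S & adj G p.1 p.2]]).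
  by case=> z v /and3P[zS vS zv]; exists z => //; exists v.
move=> no_edge; have clS : closed (adj G) (mem S).
  move=> u w uw; apply/idP/idP => [uS|wS]; apply: contraT => nS.
    by have := no_edge (u, w); rewrite /= uS nS uw.
  by have := no_edge (w, u); rewrite /= wS nS (adj_sym G) uw.
by have := closed_connect clS (conG x v0); rewrite /= xS (negbTE v0S).
Qed.

(** The induction moves into [S] an outer vertex [v] having a neighbour in [S], colours the rest,
    and colours [v] last. The hypothesis on [S] survives this choice of [v], and it saves one
    neighbour in the count of forbidden colours. *)
Lemma greedy_coloring (S : {set V}) x : x \in S ->
  (forall w, w \in S -> exists2 y, y \in S & adj G w y) ->
  exists col sg, coloring_off S col sg.
Proof.
move En: #|~: S| => n; elim: n S En => [|n IHn] S cardS xS S_nbr.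
  (* Nothing is coloured yet; extending the empty set only serves to find a default colour in
     [T]. *)
  have /card_gt0P[h _] : 0 < #|extensions s set0 (fun=> true)|.
    by apply: leq_ltn_trans (ext_lb _ _); rewrite ?cards0.
  have ST u : u \in S.
    by apply: contraT => uS; have := card0_eq cardS u; rewrite !inE uS.
  exists (fun=> h), (fun=> true); split=> [u | w _ u u']; rewrite ?ST // inE ST.
  by [].
have S_proper : S != setT.
  by apply: contraPneq cardS => ->; rewrite setCT cards0.
have [z zS [v vS zv]] := boundary_edge xS S_proper.
have v_irr : v \notin neighbours G v by rewrite inE (adj_irr G).
have [||| col0 [sg0 [hom0 inj0]]] := IHn (v |: S).
- by have := cardsC (v |: S); have := cardsC S; rewrite cardsU1 vS; lia.
- by rewrite inE xS orbT.
- move=> w; rewrite !inE => /predU1P[-> | wS].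
    by exists z; rewrite ?inE ?zS ?orbT // (adj_sym G).
  by have [y yS wy] := S_nbr w wS; exists y; rewrite ?inE ?yS ?orbT.
have {}inj0v := inj0 v (setU11 v S).
pose J := col0 @: (neighbours G v :\: (v |: S)).
have cardJ : #|neighbours G v :&: S| + #|J| <= k.+1.
  rewrite card_in_imset //; apply: leq_trans (deg_le v).
  rewrite -(cardsID S (neighbours G v)) leq_add2l subset_leq_card //.
  by apply: setDS; apply: subsetUr.
have NS_gt0 : 0 < #|neighbours G v :&: S|.
  by apply/card_gt0P; exists z; rewrite !inE zS (adj_sym G) zv.
(* The sign required at colour [t]; it is well defined since the coloured neighbours of [v] have
   distinct colours. *)
pose a t := [exists u in neighbours G v :\: (v |: S),
  (col0 u == t) && (neg G v u (+) sg0 u)].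
have aE u : u \in neighbours G v :\: (v |: S) ->
    a (col0 u) = neg G v u (+) sg0 u.
  move=> uN; apply/exists_inP/idP => [[u' u'N /andP[/eqP eq_col]] | neg_u].
    by rewrite (inj0v _ _ u'N uN eq_col).
  by exists u; rewrite // eqxx.
(* Colours forbidden to [v]: those already seen by an uncoloured neighbour of [v]. *)
pose F := \bigcup_(w in neighbours G v :&: S)
  (col0 @: (neighbours G w :\: (v |: S))).
have cardF : #|F| <= #|neighbours G v :&: S| * k.-1.
  rewrite -sum_nat_const.
  apply: leq_trans (_ : \sum_(w in neighbours G v :&: S)
      #|col0 @: (neighbours G w :\: (v |: S))| <= _).
    rewrite /F; elim/big_rec2: _ => [|w m A _ IH]; first by rewrite cards0.
    by apply: leq_trans (leq_card_setU _ _) _; rewrite leq_add2l.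
  apply: leq_sum => w; rewrite !inE => /andP[vw wS].
  apply: leq_trans (leq_imset_card _ _) _.
  have [y yS wy] := S_nbr w wS.
  have yv : y != v by apply: contraNneq vS => <-.
  have := deg_le w.
  (* Among the at most k + 1 neighbours of [w], neither [v] nor [y] is coloured yet, leaving at most
     k - 1. *)
  rewrite (cardsD1 v) (cardsD1 y (_ :\ v)) !inE yv (adj_sym G) vw wy /=.
  move=> deg_w; suff : #|neighbours G w :\: (v |: S)| <=
      #|neighbours G w :\ v :\ y| by lia.
  apply: subset_leq_card.
  apply/subsetP => u; rewrite !inE negb_or => /andP[/andP[-> uS] ->].
  by rewrite !andbT; apply: contraNneq uS => ->.
(* The number i of uncoloured neighbours of [v] satisfies 1 <= i <= k + 1 - #|J|. Hence #|J| <= k,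
   and the at most i(k - 1) forbidden colours cannot exhaust the extensions. *)
have [h hE hF] : exists2 h, h \in extensions s J a & h \notin F.
  apply/subsetPn; apply/negP => /subset_leq_card.
  rewrite leqNgt => /negP; apply; apply: leq_ltn_trans (ext_lb _ _); last by lia.
  by apply: leq_trans cardF _; rewrite leq_mul2r; apply/orP; right; lia.
move: hE; rewrite inE => /andP[hJ /existsP[c /forall_inP ext_h]].
(* The sign ambiguity [c] of the extension becomes the switching of [v]. *)
pose col u := if u == v then h else col0 u.
pose sg u := if u == v then c else sg0 u.
have new_edge u : u \in neighbours G v :\: (v |: S) ->
    h != col0 u /\ s h (col0 u) = neg G v u (+) c (+) sg0 u.
  move=> uN; have uJ : col0 u \in J by apply: imset_f.
  split; first by apply: contraNneq hJ => ->.
  by rewrite (eqP (ext_h _ uJ)) aE // addbAC.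
exists col, sg; split=> [u w uS wS uw | w wS u u'].
  rewrite /col /sg; case: (eqVneq u v) uw => [-> | uv] uw;
    case: (eqVneq w v) uw => [-> | wv] uw.
  - by rewrite (adj_irr G) in uw.
  - by apply: new_edge; rewrite !inE negb_or wv wS.
  - have [|h_neq h_sign] := @new_edge u.
      by rewrite !inE negb_or uv uS (adj_sym G).
    by rewrite eq_sym s_sym h_sign (neg_sym G) addbAC.
  - by apply: hom0; rewrite // !inE negb_or ?uv ?wv.
have new_col u0 : u0 \in neighbours G w :\: S -> u0 != v -> adj G w v ->
    h != col0 u0.
  move=> u0N u0v wv; apply: contraNneq hF => ->.
  apply/bigcupP; exists w; first by rewrite !inE wS (adj_sym G) wv.
  apply: imset_f; move: u0N; rewrite !inE negb_or => /andP[-> ->].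
  by rewrite u0v.
rewrite /col; case: eqP => [-> | /eqP uv]; case: eqP => [-> | /eqP u'v] //.
- move=> vN u'N /eqP; rewrite (negbTE (new_col _ u'N u'v _)) //.
  by move: vN; rewrite !inE => /andP[].
- move=> uN vN /esym/eqP; rewrite (negbTE (new_col _ uN uv _)) //.
  by move: vN; rewrite !inE => /andP[].
move=> uN u'N; apply: (inj0 w); first by rewrite !inE wS orbT.
  by move: uN; rewrite !inE negb_or uv.
by move: u'N; rewrite !inE negb_or u'v.
Qed.

End Greedy.

(** * The target with two additional vertices *)

Section Target.
Variables (V T : finType) (G : signed_graph V) (s : rel T).
Hypotheses (s_sym : symmetric s).
Variables (x y : V) (col : V -> T) (sg : V -> bool).
Hypothesis xy : adj G x y.
Let S : {set V} := [set x; y].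
Hypothesis col_off : coloring_off G s S col sg.

Let pole (b : bool) := if b then x else y.

(** The poles are never switched, so the required sign is corrected only by the switching of [u]. At
    most one [u] has colour [t], by the injectivity in [coloring_off]. *)
Definition pole_sign (b : bool) (t : T) : bool :=
  [exists u in neighbours G (pole b) :\: S,
    (col u == t) && (neg G (pole b) u (+) sg u)].

Definition target_adj : rel (T + bool) := fun p q => p != q.

Definition target_neg : rel (T + bool) := fun p q => (p != q) &&
  match p, q with
  | inl t, inl t' => s t t'
  | inl t, inr b | inr b, inl t => pole_sign b t
  | inr _, inr _ => neg G x y
  end.

Lemma target_adj_sym : symmetric target_adj.
Proof. by move=> p q; rewrite /target_adj eq_sym. Qed.

Lemma target_adj_irr : irreflexive target_adj.
Proof. by move=> p; rewrite /target_adj eqxx. Qed.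

Lemma target_neg_sym : symmetric target_neg.
Proof.
by move=> [t|b] [t'|b']; rewrite /target_neg eq_sym // s_sym.
Qed.

Lemma target_neg_adj : subrel target_neg target_adj.
Proof. by move=> p q /andP[]. Qed.

Definition target : signed_graph (T + bool)%type :=
  SignedGraph target_adj_sym target_adj_irr target_neg_sym target_neg_adj.

Let phi u : T + bool :=
  if u == x then inr true else if u == y then inr false else inl (col u).
Let sgn u := if u \in S then false else sg u.

Lemma target_hom : signed_hom G target phi.
Proof.
have [hom_off inj_off] := col_off.
have x_neq_y : x != y by apply: contraTneq xy => ->; rewrite (adj_irr G).
have phi_pole b : phi (pole b) = inr b.
  by rewrite /phi; case: b; rewrite /= ?eqxx // eq_sym (negbTE x_neq_y).
have sgn_pole b : sgn (pole b) = false.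
  by rewrite /sgn !inE; case: b; rewrite eqxx ?orbT.
have phi_off u : u \notin S -> phi u = inl (col u).
  by rewrite !inE negb_or /phi => /andP[/negbTE-> /negbTE->].
have sgn_off u : u \notin S -> sgn u = sg u by rewrite /sgn => /negbTE->.
have SP u : u \in S -> exists b, u = pole b.
  by rewrite !inE => /orP[] /eqP->; [exists true | exists false].
have pole_edge b u : u \notin S -> adj G (pole b) u ->
    pole_sign b (col u) = neg G (pole b) u (+) sg u.
  move=> uS bu; have bS : pole b \in S.
    by rewrite !inE /pole; case: b {bu}; rewrite eqxx ?orbT.
  have uN : u \in neighbours G (pole b) :\: S by rewrite !inE bu -in_set2 uS.
  apply/exists_inP/idP => [[w wN /andP[/eqP eq_col]] | neg_u].
    by rewrite (inj_off _ bS _ _ wN uN eq_col).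
  by exists u; rewrite // eqxx.
apply/signed_homP; exists sgn => u w uw.
rewrite /= /target_neg -/(target_adj _ _) /target_adj.
have [uS|uS] := boolP (u \in S); have [wS|wS] := boolP (w \in S).
- have [b ub] := SP u uS; have [c wc] := SP w wS.
  rewrite ub wc !phi_pole !sgn_pole !addbF in uw *.
  by case: b c uw {ub wc} => [] [] /=; rewrite ?(adj_irr G) // (neg_sym G).
- have [b ub] := SP u uS; rewrite ub in uw *.
  by rewrite phi_pole sgn_pole phi_off // sgn_off // addbF pole_edge.
- have [b wb] := SP w wS; rewrite wb in uw *.
  rewrite phi_pole sgn_pole phi_off // sgn_off // addbF (neg_sym G).
  by rewrite pole_edge // (adj_sym G).
rewrite !phi_off // !sgn_off //; have [col_neq ->] := hom_off u w uS wS uw.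
by rewrite (inj_eq inl_inj) col_neq.
Qed.

End Target.

Lemma chi_s_upper (V : finType) (G : signed_graph V) D :
  3 <= D -> Defs.connected G -> max_degree G <= D ->
  chi_s G <= (D - 1) ^ 2 * 2 ^ (D - 1) + 2.
Proof.
move=> D_ge3 conG degG; set k := D - 1.
have k_gt1 : 1 < k by rewrite /k; lia.
(* A connected graph without edges has at most one vertex, and is its own target. *)
case: (pickP [pred p | adj G p.1 p.2]) => [[x y] /= xy | no_edge]; last first.
  apply: leq_trans (_ : 2 <= _); last exact: leq_addl.
  apply: leq_trans (_ : #|V| <= _).
    apply: chi_s_le; exists V, G, id; split=> //.
    by exists G; split=> //; exists [::].
  apply/ltnW; rewrite ltnS; apply/card_le1_eqP => u w _ _.
  have /connectP[[|z p] /=] := conG u w; first by move=> _ ->.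
  by case/andP=> uz; have := no_edge (u, z); rewrite /= uz.
have deg_le v : #|neighbours G v| <= k.+1.
  have -> : k.+1 = D by rewrite /k; lia.
  exact: leq_trans (leq_bigmax (F := fun v => #|neighbours G v|) v) degG.
have [s s_sym ext_s] := exists_extension_property k_gt1 (card_ord _).
have [|col [sg col_off]] :=
  greedy_coloring deg_le s_sym ext_s conG (set21 x y).
  move=> w; rewrite !inE => /orP[] /eqP->.
    by exists y; rewrite ?inE ?eqxx ?orbT.
  by exists x; rewrite ?inE ?eqxx // (adj_sym G).
apply: chi_s_le; do 3!eexists; split; last exact: (target_hom s_sym xy col_off).
by rewrite card_sum card_ord card_bool.
Qed.

(** * Bipartite circulants with arbitrary signatures *)

Section Circulant.
Variables (n D : nat).
Hypothesis D_le : D <= n.+1.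
Hypothesis D_gt1 : 1 < D.
Variable w : {ffun 'I_n.+1 * 'I_D -> bool}.
Local Notation V := (bool * 'I_n.+1)%type.

(* (true, i) is joined to (false, i + j) for all j < D, with sign w (i, j). *)
Definition offset (u v : V) : 'I_n.+1 :=
  if u.1 then (v.2 - u.2)%R else (u.2 - v.2)%R.

Definition circ_adj : rel V := fun u v => (u.1 != v.1) && (offset u v < D).

Definition circ_neg : rel V := fun u v => circ_adj u v &&
  oapp (fun j => w (if u.1 then u.2 else v.2, j)) false (insub (val (offset u v))).

Lemma circ_adj_sym : symmetric circ_adj.
Proof.
by move=> [b i] [c j]; rewrite /circ_adj /offset /= eq_sym; case: b; case: c.
Qed.

Lemma circ_adj_irr : irreflexive circ_adj.
Proof. by move=> u; rewrite /circ_adj eqxx. Qed.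

Lemma circ_neg_sym : symmetric circ_neg.
Proof.
move=> u v; rewrite /circ_neg circ_adj_sym; case: u v => [b i] [c j].
by rewrite /circ_adj /offset /=; case: b; case: c.
Qed.

Lemma circ_neg_adj : subrel circ_neg circ_adj.
Proof. by move=> u v /andP[]. Qed.

Definition circulant : signed_graph V :=
  SignedGraph circ_adj_sym circ_adj_irr circ_neg_sym circ_neg_adj.

Lemma circulant_max_degree : max_degree circulant <= D.
Proof.
apply/bigmax_leqP => u _.
rewrite -[leqRHS]card_ord -(card_codom (f := widen_ord D_le)); last first.
  by move=> i j /(congr1 val) /= /val_inj.
have off_inj : {in [set v | adj circulant u v] &, injective (offset u)}.
  move=> [b i] [c j]; rewrite !inE /= /circ_adj /offset /=.
  case: u => [[] l] /=; case: b; case: c => //= _ _.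
    by move/addIr->.
  by move/addrI/oppr_inj->.
rewrite -(card_in_imset off_inj) subset_leq_card //.
apply/subsetP => l /imsetP[v]; rewrite inE => /andP[_ lt_D] ->.
by apply/codomP; exists (Ordinal lt_D); apply: val_inj.
Qed.

(** Offsets 1 and 0 both occur since 1 < D, and lead from (true, i) through (false, i + 1) to (true,
    i + 1). *)
Lemma circulant_connected : Defs.connected circulant.
Proof.
have sym : connect_sym (adj circulant) by apply: sym_connect_sym; apply: circ_adj_sym.
pose o : V := (true, ord0).
have adjE i j : adj circulant (true, i) (false, j) = ((j - i)%R < D) by [].
have across b i : connect (adj circulant) (true, i) (b, i).
  case: b; first exact: connect0.
  by apply: connect1; rewrite adjE subrr; apply: ltnW D_gt1.
have next i : connect (adj circulant) (true, i) (true, (i + Zp1)%R).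
  apply: connect_trans (_ : connect _ (false, (i + Zp1)%R) _); last first.
    by rewrite sym; apply: across.
  apply: connect1; rewrite adjE addrC addKr /=.
  by apply: leq_ltn_trans (leq_mod _ _) _.
have from0 m : connect (adj circulant) o (true, inZp m).
  elim: m => [|m IHm].
    by rewrite (_ : inZp 0 = ord0) ?connect0 //; apply: val_inj; rewrite /= mod0n.
  apply: connect_trans IHm _; rewrite (_ : inZp m.+1 = (inZp m + Zp1)%R) //.
  by apply: val_inj; rewrite /= modnDm addn1.
have to_o u : connect (adj circulant) o u.
  case: u => b i; apply: connect_trans (across b i).
  by have := from0 i; rewrite valZpK.
by move=> u v; apply: connect_trans (to_o v); rewrite sym.
Qed.

End Circulant.

(** * Counting signatures for the lower bound *)

Lemma count_signatures n D m : D <= n.+1 ->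
  (forall w, chi_s (@circulant n D w) <= m) ->
  2 ^ (n.+1 * D) <= 2 ^ (m ^ 2) * (2 * m) ^ (2 * n.+1).
Proof.
move=> D_le chi_le.
pose V := (bool * 'I_n.+1)%type.
pose code := ({ffun 'I_m * 'I_m -> bool} *
              ({ffun V -> 'I_m} * {ffun V -> bool}))%type.
pose decode (c : code) : {ffun 'I_n.+1 * 'I_D -> bool} := [ffun p =>
  let u := (true, p.1) : V in let v := (false, p.1 + widen_ord D_le p.2)%R : V in
  c.1 (c.2.1 u, c.2.1 v) (+) c.2.2 u (+) c.2.2 v].
have card_code : #|{: code}| = 2 ^ (m ^ 2) * (2 * m) ^ (2 * n.+1).
  rewrite !card_prod !card_ffun !card_prod !card_ord !card_bool mulnn.
  by congr (_ * _); rewrite expnMn mulnC.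
have -> : 2 ^ (n.+1 * D) = #|{ffun 'I_n.+1 * 'I_D -> bool}|.
  by rewrite card_ffun card_prod !card_ord card_bool.
rewrite -card_code; apply: leq_trans (leq_imset_card decode _).
rewrite -cardsT subset_leq_card //; apply/subsetP => w _.
have [W [H [phi [cardW /signed_homP[sg hom_phi]]]]] := chi_s_hom (circulant w).
have cardW_le : #|W| <= m by rewrite cardW.
(* Targets of different orders are all embedded in ['I_m], so that one code space serves every [w];
   surjectivity of [decode] then gives the count. *)
pose r t : 'I_m := widen_ord cardW_le (enum_rank t).
have r_inj : injective r.
  by move=> t t' /(congr1 val) /= /val_inj /enum_rank_inj.
pose N : {ffun 'I_m * 'I_m -> bool} :=
  [ffun p => [exists t, exists t', [&& r t == p.1, r t' == p.2 & neg H t t']]].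
have NE t t' : N (r t, r t') = neg H t t'.
  rewrite ffunE /=; apply/existsP/idP => [[t1 /existsP[t2]] | neg_tt'].
    by case/and3P=> /eqP/r_inj-> /eqP/r_inj->.
  by exists t; apply/existsP; exists t'; rewrite !eqxx.
clearbody N; apply/imsetP; exists (N, ([ffun u => r (phi u)], [ffun u => sg u])) => //.
apply/ffunP => -[i j]; rewrite ffunE /= !ffunE NE.
set u := (true, i); set v := (false, _).
have off_uv : offset u v = widen_ord D_le j by rewrite /offset /= addrC addKr.
have uv : adj (circulant w) u v by rewrite /= /circ_adj off_uv /=.
have [_ ->] := hom_phi u v uv.
rewrite /= /circ_neg (_ : circ_adj D u v) // off_uv /= valK /=.
by rewrite addbAC !addbK.
Qed.

(** If b < a, then (a/b)^n >= 1 + n/b, which exceeds c at n = cb + n0. *)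
Lemma leq_of_exp_leq a b c n0 :
  (forall n, n0 <= n -> a ^ n <= c * b ^ n) -> a <= b.
Proof.
move=> exp_le; rewrite leqNgt; apply/negP => lt_ba.
have growth n : b ^ n * (n + b) <= a ^ n * b.
  elim: n => [|n IHn]; first by rewrite add0n.
  apply: leq_trans (_ : b.+1 * (b ^ n * (n + b)) <= _).
    by rewrite expnS; nia.
  by rewrite expnS -mulnA leq_mul.
have [b0|b_gt0] := posnP b.
  have := exp_le n0.+1 (leqnSn _); rewrite b0 exp0n // muln0 leqn0 expn_eq0.
  by case: a lt_ba {growth exp_le}.
have n_ge : n0 <= c * b + n0 by apply: leq_addl.
have := exp_le _ n_ge; have := growth (c * b + n0).
have : 0 < b ^ (c * b + n0) by rewrite expn_gt0 b_gt0.
move: (b ^ _) (a ^ _) => B A; nia.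
Qed.

Lemma signature_bound D m : 1 < D ->
  (forall n (w : {ffun 'I_n.+1 * 'I_D -> bool}), D <= n.+1 ->
     chi_s (circulant w) <= m) ->
  2 ^ D <= (2 * m) ^ 2.
Proof.
move=> D_gt1 chi_le.
(* The exponent is the size n + 1 of one side; starting at D keeps the D offsets distinct and
   excludes exponent 0. *)
apply: (@leq_of_exp_leq _ _ (2 ^ (m ^ 2)) D) => -[|n] D_le.
  by have := leq_trans D_gt1 D_le.
rewrite -!expnM [D * _]mulnC; apply: count_signatures => // w.
exact: chi_le.
Qed.

(** * Real exponents and the maximum over the family *)

Local Open Scope ring_scope.

Lemma powR_half_bound (R : realType) (D m : nat) :
  (2 ^ D <= (2 * m) ^ 2)%N -> (2 : R) `^ (D%:R / 2 - 1) <= m%:R.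
Proof.
move=> le_m; have two_neq0 : (2 : R) != 0 by rewrite pnatr_eq0.
rewrite -(@ler_pXn2r _ 2) ?nnegrE ?powR_ge0 ?ler0n // -powR_mulrn ?powR_ge0 //.
rewrite -powRrM (_ : _ * 2 = D%:R - 2); last by field.
rewrite powRB ?two_neq0 ?implybT // !powR_mulrn // ler_pdivrMr ?exprn_gt0 //.
by rewrite -!natrX -natrM ler_nat mulnC -expnMn.
Qed.

Theorem theorem1p1 (R : realType) (Delta : nat) (hDelta : (3 <= Delta)%N) :
  exists m : nat,
    is_family_chi_s (bounded_degree_family Delta) m /\
    (2 : R) `^ (Delta%:R / 2 - 1) <= m%:R /\
    (m <= (Delta - 1) ^ 2 * 2 ^ (Delta - 1) + 2)%N.
Proof.
(* The upper bound is needed first: a maximum exists because the attained values are bounded and, by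
   the circulants, nonempty. *)
pose attained n := boolp.asbool (exists (V : finType) (G : signed_graph V),
  bounded_degree_family Delta G /\ chi_s G = n).
have circ_in n (w : {ffun 'I_n.+1 * 'I_Delta -> bool}) : (Delta <= n.+1)%N ->
    bounded_degree_family Delta (circulant w).
  move=> D_le; split; first exact: circulant_connected (ltnW hDelta) w.
  exact: circulant_max_degree.
have ex_attained : exists n, attained n.
  pose w : {ffun 'I_Delta.+1 * 'I_Delta -> bool} := [ffun=> true].
  exists (chi_s (circulant w)); apply/boolp.asboolP; do 2!eexists; split=> //.
  exact: circ_in.
have attained_le n :
    attained n -> (n <= (Delta - 1) ^ 2 * 2 ^ (Delta - 1) + 2)%N.
  by move=> /boolp.asboolP[V [G [[conG degG] <-]]]; apply: chi_s_upper.
case: (ex_maxnP ex_attained attained_le) => m m_attained m_max.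
have chi_le (V : finType) (G : signed_graph V) :
    bounded_degree_family Delta G -> (chi_s G <= m)%N.
  by move=> FG; apply/m_max/boolp.asboolP; exists V, G.
exists m; split; first by split=> //; apply/boolp.asboolP.
split; last exact: attained_le.
apply: powR_half_bound; apply: signature_bound (ltnW hDelta) _ => n w D_le.
exact/chi_le/circ_in.
Qed.
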